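(* Let $n$ and $m$ be positive even integers, so that $$C_n\times C_m=(C_{2^{\alpha_1}}\times C_{2^{\beta_1}})\times(C_{\mathrm p_2^{\alpha_2}}\times C_{\mathrm p_2^{\beta_2}})\times\cdots\times(C_{\mathrm p_s^{\alpha_s}}\times C_{\mathrm p_s^{\beta_s}}),$$ where $\alpha_1,\beta_1\ge1$, $\mathrm p_2,\dots,\mathrm p_s$ are distinct odd primes and $\alpha_i,\beta_i\ge0$ for $i\in\{2,\dots,s\}$; put $\mathrm p_1=2$. Every subgroup $\mathcal C$ of $C_n\times C_m\subset SO(2)\times SO(2)$ with two generators which falls into class $\mathrm E_1$ is written uniquely in the form $$\mathcal C=\mathrm A_1\times\mathrm A_2\times\cdots\times\mathrm A_s,$$ where $\mathrm A_i$ is a subgroup of $C_{\mathrm p_i^{\alpha_i}}\times C_{\mathrm p_i^{\beta_i}}$, $i\in\{1,\dots,s\}$. The group $\mathrm A_1$ is not trivial and must be cyclic; in particular it is one of the groups $$\left\{\left(R\left(\tfrac{2\pi}{2^{\kappa}}\,r\,i_1\right),R\left(\tfrac{2\pi}{2^{\kappa}}\,i_1\right)\right):\ i_1\in\{0,1,\dots,2^{\kappa}-1\}\right\},$$ with $1\le\kappa\le\min(\alpha_1,\beta_1)$ and $r\in\{1,2,\dots,2^{\kappa}-1\}\setminus\{2,2\cdot2,\dots,(2^{\kappa-1}-1)2\}$. At least one of the $\mathrm A_i$, $i\in\{2,\dots,s\}$ (which may otherwise be trivial), has two generators. Moreover, with $x$ a generator of $C_n$ and $y$ a generator of $C_m$,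 two generators of $\mathcal C$ are given by $g_1=(x^{\mathcal A_1},y^{\mathcal B_1})$ and $g_2=(x^{\mathcal A_2},y^{\mathcal B_2})$, where $\mathcal A_1,\mathcal B_1,\mathcal A_2,\mathcal B_2$ are the following integers, for some values of the parameters in the ranges specified in the context. Here $N_0=0$, $N_1=\nu$, $N_2=\nu+\chi$, $N_3=\nu+\chi+\tau$, $N_4=\nu+\chi+\tau+\psi$, $N_5=N_4+\sigma$, $N_6=N_5+\theta$, $N_7=N_6+\phi$, $N_8=N_7+\xi$, and $\sum_{(q)}$ denotes the sum over $N_{q-1}<i\le N_q$: $$\mathcal A_1=\sum_{(1)}r_ip_i^{a_i-k_i}\tfrac{n}{p_i^{a_i}}+\sum_{(2)}p_i^{a_i-k_i}\tfrac{n}{p_i^{a_i}}+\sum_{(3)}j_i\tfrac{n}{p_i^{a_i}}+\sum_{(4)}p_i^{a_i-k_i}\tfrac{n}{p_i^{a_i}}+\sum_{(5)}r_ip_i^{a_i-k_i}\tfrac{n}{p_i^{a_i}}+\sum_{(6)}p_i^{a_i-k_i}\tfrac{n}{p_i^{a_i}}+\sum_{(7)}t_i\tfrac{n}{p_i^{a_i}}+\sum_{(8)}p_i^{a_i-k_i}\tfrac{n}{p_i^{a_i}},$$ $$\mathcal B_1=\sum_{(1)}p_i^{b_i-k_i}\tfrac{m}{p_i^{b_i}}+\sum_{(2)}\rho_ip_i^{b_i-k_i+1}\tfrac{m}{p_i^{b_i}}+\sum_{(3)}p_i^{b_i-k_i}\tfrac{m}{p_i^{b_i}}+\sum_{(4)}j_i\tfrac{m}{p_i^{b_i}}+\sum_{(5)}p_i^{b_i-k_i}\tfrac{m}{p_i^{b_i}}+\sum_{(6)}\rho_ip_i^{b_i-k_i+1}\tfrac{m}{p_i^{b_i}}+\sum_{(7)}p_i^{b_i-k_i}\tfrac{m}{p_i^{b_i}}+\sum_{(8)}t_i\tfrac{m}{p_i^{b_i}},$$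 $$\mathcal A_2=\sum_{(5)}p_i^{a_i-l_i}\tfrac{n}{p_i^{a_i}}+\sum_{(7)}p_i^{a_i-l_i}\tfrac{n}{p_i^{a_i}},\qquad \mathcal B_2=\sum_{(6)}p_i^{b_i-l_i}\tfrac{m}{p_i^{b_i}}+\sum_{(8)}p_i^{b_i-l_i}\tfrac{m}{p_i^{b_i}}.$$
   Context: $R(\theta)=\begin{pmatrix}\cos\theta&\sin\theta\\-\sin\theta&\cos\theta\end{pmatrix}$; $C_N=\{R(2\pi r/N):0\le r\le N-1\}\subset SO(2)$, and for $N'\mid N$ one regards $C_{N'}\subset C_N$. Products are internal direct products. A group ''with two generators'' means a group that can be generated by two elements but is not cyclic. Class $\mathrm E_1$: subgroups of $C_n\times C_m$ containing $(-I,-I)$ but not containing the whole group $\{(I,I),(-I,I),(I,-I),(-I,-I)\}$. Parameter ranges ($k_i,l_i$ are non-negative integers; empty sums are $0$): - $\nu,\chi,\tau,\psi,\sigma,\theta,\phi,\xi$ are non-negative integers with sum at most $s$, and $(p_i^{a_i},p_i^{b_i})$, $i=1,\dots,s$, is a permutation of the $s$ pairs $(\mathrm p_i^{\alpha_i},\mathrm p_i^{\beta_i})$; - $0<i\le N_1$: one of the primes $p_1,\dots,p_\nu$ is $2$; if $p_t=2$ then $1\le k_t\le\min(a_t,b_t)$ and $r_t\in\{1,\dots,2^{k_t}-1\}\setminus\{2,2\cdot2,\dots,(2^{k_t-1}-1)2\}$; for the other such $i$, $k_i\le\min(a_i,b_i)$ and $r_i\in\{0,\dots,p_i^{k_i}-1\}$;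 - $N_1<i\le N_2$: $1\le k_i\le\min(a_i,b_i)$, $\rho_i\in\{0,\dots,p_i^{k_i-1}-1\}$; - $N_2<i\le N_3$: $a_i<k_i\le b_i$, $j_i\in\{0,\dots,p_i^{a_i}-1\}$; - $N_3<i\le N_4$: $b_i<k_i\le a_i$, $j_i\in\{0,\dots,p_i^{b_i}-1\}$; - $N_4<i\le N_5$: $1\le l_i\le k_i\le\min(a_i,b_i)$, $r_i\in\{0,\dots,p_i^{k_i-l_i}-1\}$; - $N_5<i\le N_6$: $1\le l_i<k_i\le\min(a_i,b_i)$, $\rho_i\in\{0,\dots,p_i^{k_i-l_i-1}-1\}$; - $N_6<i\le N_7$: $1\le l_i\le a_i<k_i\le b_i$, $t_i\in\{0,\dots,p_i^{a_i-l_i}-1\}$; - $N_7<i\le N_8$: $1\le l_i\le b_i<k_i\le a_i$, $t_i\in\{0,\dots,p_i^{b_i-l_i}-1\}$. Some or all of the exponents $a_i,b_i$ with $i\le N_4$, $i\neq t$, may be zero, while $a_ib_i\neq0$ for at least one $i$ with $N_4<i\le N_8$. *)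

(* Defs.v *)
From HB Require Import structures.
From mathcomp Require Import all_boot all_order all_fingroup all_algebra.
From mathcomp Require Import all_classical all_reals all_analysis.

Set Implicit Arguments.
Unset Strict Implicit.
Unset Printing Implicit Defensive.

Import GRing.Theory.

Local Open Scope classical_set_scope.
Local Open Scope ring_scope.

(* Subgroups of the unit group of T.  They are used with T := 'M[R]_2 and
   T := 'M[R]_2 * 'M[R]_2 (componentwise operations), whose unit groups
   contain SO(2) and SO(2) x SO(2). *)
Definition is_subgroup (T : unitRingType) (G : set T) : Prop :=
  [/\ forall g, G g -> g \is a GRing.unit,
      G 1,
      forall g h, G g -> G h -> G (g * h)
    & forall g, G g -> G g^-1].

Definition subgroup_gen (T : unitRingType) (S : set T) : set T :=
  [set g | forall H : set T, is_subgroup H -> S `<=` H -> H g].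

Definition is_cyclic (T : unitRingType) (G : set T) : Prop :=
  exists g, G = subgroup_gen [set g].

Definition two_generators (T : unitRingType) (G : set T) : Prop :=
  (exists g h, G = subgroup_gen [set g; h]) /\ ~ is_cyclic G.

Definition internal_dprod (T : unitRingType) (s : nat) (A : 'I_s -> set T)
    (G : set T) : Prop :=
  [/\ forall i, is_subgroup (A i),
      forall i j, i != j ->
        forall g h, A i g -> A j h -> g * h = h * g,
      G = [set \prod_(i < s) a i | a in [set a | forall i, A i (a i)]]
    & forall a b : 'I_s -> T,
        (forall i, A i (a i)) -> (forall i, A i (b i)) ->
        \prod_(i < s) a i = \prod_(i < s) b i -> a =1 b].

Definition rotmx (R : realType) (t : R) : 'M[R]_2 :=
  \matrix_(i < 2, j < 2)
    if i == 0 then (if j == 0 then cos t else sin t)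
    else (if j == 0 then - sin t else cos t).

Definition rotgrp (R : realType) (N : nat) : set 'M[R]_2 :=
  [set rotmx (2 * pi * r%:R / N%:R) | r in [set r : nat | (r < N)%N]].
Arguments rotgrp : clear implicits.

Definition class_E1 (R : realType) (n m : nat)
    (G : set ('M[R]_2 * 'M[R]_2)%type) : Prop :=
  [/\ is_subgroup G,
      G `<=` rotgrp R n `*` rotgrp R m,
      G (- 1, - 1)
    & ~ ([set (1, 1); (- 1, 1); (1, - 1); (- 1, - 1)] `<=` G)].

(* {1, ..., 2^k - 1} without {2, 2*2, ..., (2^(k-1) - 1)*2} *)
Definition two_range (k r : nat) : bool :=
  ((1 <= r <= 2 ^ k - 1) &&
   (r \notin [seq q * 2 | q <- iota 1 (2 ^ (k - 1) - 1)]))%N.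

Definition diag2 (R : realType) (k r : nat) :
    set ('M[R]_2 * 'M[R]_2)%type :=
  [set (rotmx (2 * pi / (2 ^ k)%:R * r%:R * i%:R),
        rotmx (2 * pi / (2 ^ k)%:R * i%:R))
     | i in [set i : nat | (i < 2 ^ k)%N]].
Arguments diag2 : clear implicits.

Definition decomposition (R : realType) (s : nat) (p al be : 'I_s -> nat)
    (G : set ('M[R]_2 * 'M[R]_2)%type)
    (A : 'I_s -> set ('M[R]_2 * 'M[R]_2)%type) : Prop :=
  (forall i, is_subgroup (A i) /\
     A i `<=` rotgrp R (p i ^ al i) `*` rotgrp R (p i ^ be i)) /\
  internal_dprod A G.

(* The first eight fields are the block sizes nu, chi, tau, psi, sigma, theta,
   phi, xi; then p_i, a_i, b_i and k_i, l_i, r_i, rho_i, j_i, t_i.  Only the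
   values in the blocks where a parameter is in use matter. *)
Record params (s : nat) := Params {
  p_nu : nat; p_chi : nat; p_tau : nat; p_psi : nat;
  p_sigma : nat; p_theta : nat; p_phi : nat; p_xi : nat;
  p_p : 'I_s -> nat; p_a : 'I_s -> nat; p_b : 'I_s -> nat;
  p_k : 'I_s -> nat; p_l : 'I_s -> nat; p_r : 'I_s -> nat;
  p_rho : 'I_s -> nat; p_j : 'I_s -> nat; p_t : 'I_s -> nat }.

Local Open Scope nat_scope.

(* N_q, for 0 <= q <= 8 *)
Definition bound_N (s : nat) (P : params s) (q : nat) : nat :=
  sumn (take q [:: p_nu P; p_chi P; p_tau P; p_psi P;
                   p_sigma P; p_theta P; p_phi P; p_xi P]).

(* Indices start at 0 in 'I_s, so that N_(q-1) < i <= N_q for indices starting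
   at 1 reads N_(q-1) <= i < N_q here. *)
Definition in_block (s : nat) (P : params s) (q : nat) (i : 'I_s) : bool :=
  bound_N P q.-1 <= i < bound_N P q.

(* The pairs (p_i^al_i, p_i^be_i) are permuted as labelled by their primes:
   sg also carries the prime when both exponents are 0. *)
Definition admissible (s : nat) (p al be : 'I_s -> nat) (P : params s) : Prop :=
  let q := p_p P in let a := p_a P in let b := p_b P in
  let k := p_k P in let l := p_l P in let r := p_r P in
  let rho := p_rho P in let j := p_j P in let t := p_t P in
  bound_N P 8 <= s /\
  (exists sg : {perm 'I_s}, forall i,
     [/\ q i = p (sg i), a i = al (sg i) & b i = be (sg i)]) /\
  (exists i, in_block P 1 i /\ q i = 2) /\
  (forall i, in_block P 1 i -> q i = 2 ->
     1 <= k i <= minn (a i) (b i) /\ two_range (k i) (r i)) /\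
  (forall i, in_block P 1 i -> q i <> 2 ->
     k i <= minn (a i) (b i) /\ r i < q i ^ k i) /\
  (forall i, in_block P 2 i ->
     1 <= k i <= minn (a i) (b i) /\ rho i < q i ^ (k i - 1)) /\
  (forall i, in_block P 3 i -> a i < k i <= b i /\ j i < q i ^ a i) /\
  (forall i, in_block P 4 i -> b i < k i <= a i /\ j i < q i ^ b i) /\
  (forall i, in_block P 5 i ->
     [/\ 1 <= l i, l i <= k i, k i <= minn (a i) (b i)
       & r i < q i ^ (k i - l i)]) /\
  (forall i, in_block P 6 i ->
     [/\ 1 <= l i, l i < k i, k i <= minn (a i) (b i)
       & rho i < q i ^ (k i - l i - 1)]) /\
  (forall i, in_block P 7 i ->
     [/\ 1 <= l i, l i <= a i, a i < k i <= b i
       & t i < q i ^ (a i - l i)]) /\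
  (forall i, in_block P 8 i ->
     [/\ 1 <= l i, l i <= b i, b i < k i <= a i
       & t i < q i ^ (b i - l i)]) /\
  (exists i : 'I_s, bound_N P 4 <= i < bound_N P 8 /\ a i * b i <> 0).

(* For admissible parameters, n = prod p_i^al_i and m = prod p_i^be_i, all the
   subtractions and divisions in the next four definitions are exact. *)
Definition expA1 (s : nat) (n : nat) (P : params s) : nat :=
  let p := p_p P in let a := p_a P in let k := p_k P in
  let r := p_r P in let j := p_j P in let t := p_t P in
  \sum_(i < s | in_block P 1 i) r i * p i ^ (a i - k i) * (n %/ p i ^ a i)
  + \sum_(i < s | in_block P 2 i) p i ^ (a i - k i) * (n %/ p i ^ a i)
  + \sum_(i < s | in_block P 3 i) j i * (n %/ p i ^ a i)
  + \sum_(i < s | in_block P 4 i) p i ^ (a i - k i) * (n %/ p i ^ a i)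
  + \sum_(i < s | in_block P 5 i) r i * p i ^ (a i - k i) * (n %/ p i ^ a i)
  + \sum_(i < s | in_block P 6 i) p i ^ (a i - k i) * (n %/ p i ^ a i)
  + \sum_(i < s | in_block P 7 i) t i * (n %/ p i ^ a i)
  + \sum_(i < s | in_block P 8 i) p i ^ (a i - k i) * (n %/ p i ^ a i).

Definition expB1 (s : nat) (m : nat) (P : params s) : nat :=
  let p := p_p P in let b := p_b P in let k := p_k P in
  let rho := p_rho P in let j := p_j P in let t := p_t P in
  \sum_(i < s | in_block P 1 i) p i ^ (b i - k i) * (m %/ p i ^ b i)
  + \sum_(i < s | in_block P 2 i)
      rho i * p i ^ (b i - k i + 1) * (m %/ p i ^ b i)
  + \sum_(i < s | in_block P 3 i) p i ^ (b i - k i) * (m %/ p i ^ b i)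
  + \sum_(i < s | in_block P 4 i) j i * (m %/ p i ^ b i)
  + \sum_(i < s | in_block P 5 i) p i ^ (b i - k i) * (m %/ p i ^ b i)
  + \sum_(i < s | in_block P 6 i)
      rho i * p i ^ (b i - k i + 1) * (m %/ p i ^ b i)
  + \sum_(i < s | in_block P 7 i) p i ^ (b i - k i) * (m %/ p i ^ b i)
  + \sum_(i < s | in_block P 8 i) t i * (m %/ p i ^ b i).

Definition expA2 (s : nat) (n : nat) (P : params s) : nat :=
  let p := p_p P in let a := p_a P in let l := p_l P in
  \sum_(i < s | in_block P 5 i) p i ^ (a i - l i) * (n %/ p i ^ a i)
  + \sum_(i < s | in_block P 7 i) p i ^ (a i - l i) * (n %/ p i ^ a i).

Definition expB2 (s : nat) (m : nat) (P : params s) : nat :=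
  let p := p_p P in let b := p_b P in let l := p_l P in
  \sum_(i < s | in_block P 6 i) p i ^ (b i - l i) * (m %/ p i ^ b i)
  + \sum_(i < s | in_block P 8 i) p i ^ (b i - l i) * (m %/ p i ^ b i).

(* Main.v *)
Require Import Defs.
From HB Require Import structures.
From mathcomp Require Import all_boot all_order all_fingroup all_algebra.
From mathcomp Require Import all_classical all_reals all_analysis.
From mathcomp Require Import zify ring lra.

(** Fix generators [x] of [C_n] and [y] of [C_m].  A subgroup [G] of
    [C_n x C_m] splits as the direct product of its primary parts
    [A_i = G :&: (C_(p_i^al_i) x C_(p_i^be_i))]: the Chinese remainder theorem
    provides exponents [e_i] with [e_i = 1] modulo
    [p_i^(al_i + be_i)] and [e_i = 0] modulo the other such powers, so that [g] is the product of the [g^e_i]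
    ([torsion_dprod]).  The same exponents show that any decomposition inside
    the primary parts is this one ([dprod_factor_unique]), and that
    multiplying together generators [g_i, h_i] of the parts yields two
    generators of [G] ([dprod_generators]).

    Inside the [i]-th part the pairs of exponents [(u, v)] with
    [(X^u, Y^v)] in [A_i], where [X] and [Y] have order [p^a] and [p^b], form a
    lattice of pairs that contains [(p^a, 0)] and [(0, p^b)].  Its Hermite normal
    form consists of [(w, p^(b-k))] and [(p^(a-l), 0)], and there is a second
    one with the coordinates exchanged.  Let [p^d] be the largest order of a
    second component and [p^c] the largest order of a first one.  If [c <= d]
    the first form is used and [p^(a-c)] divides [w]; if [d < c] the second one
    is used and its free entry is divisible by [p^(b-d)].  Splitting further by
    whether [k] exceeds the exponent of the other coordinate, and by whether [l]
    is zero, gives the eight parameter families ([lattice_classification]).  Families 1 to 4 need one generator, families 5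
    to 8 need two.

    For [p = 2] the class [E_1] says that [(-I,-I)] belongs to [A_1] and
    [(-I,I)] does not; this leaves only family 1, with odd [w] and [k > 0]
    ([lattice_single_involution]).  If every part were cyclic, or of families
    1 to 4, then [G] would be cyclic, so some other part needs two generators.
    Sorting the primes by family produces the consecutive blocks of indices of
    the final formulas ([shape_params_sorted]).  All this relies on a single fact
    about rotations: [R(2 pi / N)] is a primitive [N]-th root of unity
    ([rotgen_prim]). *)

Set Implicit Arguments.
Unset Strict Implicit.
Unset Printing Implicit Defensive.

Import Order.TTheory GRing.Theory Num.Theory.

Local Open Scope classical_set_scope.
Local Open Scope nat_scope.

(** * Lattices of exponents *)

(** Subtraction is encoded as cancellation, because exponents are naturals:
    these are the subgroups of [Z^2] containing [(M, 0)] and [(0, N)], seen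
    through their pairs of naturals. *)
Definition lattice (M N : nat) (L : nat -> nat -> Prop) : Prop :=
  [/\ forall u v u' v', L u v -> L u' v' -> L (u + u') (v + v'),
      forall u v u' v', L u v -> L (u + u') (v + v') -> L u' v',
      L M 0
    & L 0 N].

Lemma lattice_swap M N L : lattice M N L -> lattice N M (fun v u => L u v).
Proof.
by case=> La Ls LM LN; split=> // [u v u' v'|u v u' v']; [apply: La|apply: Ls].
Qed.

Lemma lattice0 M N L : lattice M N L -> L 0 0.
Proof. by case=> _ Ls LM _; apply: (Ls M 0); rewrite ?addn0. Qed.

Lemma latticeM M N L c u v : lattice M N L -> L u v -> L (c * u) (c * v).
Proof.
move=> LL Luv; elim: c => [|c IHc]; first exact: lattice0 LL.
by case: LL => La _ _ _; rewrite !mulSn; apply: La.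
Qed.

Lemma lattice_modl M N L u u' v : lattice M N L ->
  u = u' %[mod M] -> L u v -> L u' v.
Proof.
move=> LL uu' Luv; case: (LL) => La Ls LM _.
have LcM c : L (c * M) 0 by rewrite -[X in L _ X](muln0 c); apply: latticeM LL LM.
rewrite (divn_eq u' M) -uu' -[v]add0n; apply: La (LcM _) _.
by apply: (Ls _ _ _ _ (LcM (u %/ M))); rewrite -divn_eq.
Qed.

Lemma lattice_modr M N L u v v' : lattice M N L ->
  v = v' %[mod N] -> L u v -> L u v'.
Proof. by move=> /lattice_swap LL; apply: (lattice_modl LL). Qed.

(** The least positive element divides the others, by Euclidean division. *)
Lemma subtractive_ideal (I : nat -> Prop) N : 0 < N -> I N ->
    (forall u v, I u -> I v -> I (u + v)) ->
    (forall u v, I u -> I (u + v) -> I v) ->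
  exists2 d, d %| N & forall u, I u <-> d %| u.
Proof.
move=> N0 IN Ia Is.
have exI : exists d, `[< 0 < d /\ I d >] by exists N; apply/asboolP.
have I0 : I 0 by apply: (Is N); rewrite ?addn0.
have [d /asboolP[d0 Id] dmin] := ex_minnP exI.
have IM c : I (c * d) by elim: c => // c IHc; rewrite mulSn; apply: Ia.
have dvdI u : I u -> d %| u.
  move=> Iu; rewrite /dvdn; case: posnP => // r0.
  have /dmin : `[< 0 < u %% d /\ I (u %% d) >].
    by apply/asboolP; split=> //; apply: (Is _ _ (IM (u %/ d))); rewrite -divn_eq.
  by rewrite leqNgt ltn_mod d0.
exists d; first exact: dvdI.
by move=> u; split=> [/dvdI //|/dvdnP[c ->]].
Qed.

(** The second coordinates of [L], and the first coordinates of the elements of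
    [L] on the first axis, are ideals containing [p ^ b] and [p ^ a], hence
    generated by powers of [p]; [w] is the first coordinate of an element lying
    over the generator of the former, reduced modulo the latter. *)
Lemma hermite_form p a b L : prime p -> lattice (p ^ a) (p ^ b) L ->
  exists k l w, [/\ k <= b, l <= a, w < p ^ (a - l), L w (p ^ (b - k)) &
    [/\ L (p ^ (a - l)) 0, forall u v, L u v -> p ^ (b - k) %| v &
       forall u v, L u v -> exists i j,
         u = i * w + j * p ^ (a - l) %[mod p ^ a] /\ v = i * p ^ (b - k)]].
Proof.
move=> p_pr LL; case: (LL) => La Ls LM LN.
have pa0 e : 0 < p ^ e by rewrite expn_gt0 prime_gt0.
have sub u v u' v' : L u v -> L u' (v + v') -> L (u' + (p ^ a - 1) * u) v'.
  move=> Luv Lu'; apply: Ls Luv _.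
  apply: (lattice_modl LL) Lu'.
  (* [u' - u] is represented by [u' + (p ^ a - 1) * u]. *)
  suff -> : u + (u' + (p ^ a - 1) * u) = u * p ^ a + u' by rewrite modnMDl.
  by have := pa0 a; nia.
have [_ /(dvdn_pfactor _ _ p_pr)[e le_e ->] kerP] :
    exists2 d, d %| p ^ a & forall u, L u 0 <-> d %| u.
  apply: subtractive_ideal => // u v; first exact: La.
  by move=> Lu; apply: (Ls _ _ _ _ Lu).
have [_ /(dvdn_pfactor _ _ p_pr)[d le_d ->] imP] :
    exists2 d, d %| p ^ b & forall v, (exists u, L u v) <-> d %| v.
  apply: subtractive_ideal => //; first by exists 0.
    by move=> v v' [u Lu] [u' Lu']; exists (u + u'); apply: La.
  by move=> v v' [u Lu] [u' Lu']; eexists; apply: sub Lu Lu'.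
have [w0 Lw0] := (imP (p ^ d)).2 (dvdnn _).
have Lpe : L (p ^ e) 0 by apply/kerP.
set w := w0 %% p ^ e.
have Lw : L w (p ^ d).
  apply: (Ls (w0 %/ p ^ e * p ^ e) 0); last by rewrite -divn_eq.
  by apply/kerP/dvdn_mull.
exists (b - d), (a - e), w; rewrite !subKn ?leq_subr //; split=> //.
  by rewrite ltn_mod.
split=> // [u v Luv|u v Luv]; first by apply/imP; exists u.
have /dvdnP[i Dv] : p ^ d %| v by apply/imP; exists u.
exists i.
have Lker : L (u + (p ^ a - 1) * (i * w)) 0.
  by apply: (sub _ _ _ _ (latticeM i LL Lw)); rewrite -Dv addn0.
have /dvdnP[j Dj] := (kerP _).1 Lker; exists j; split=> //.
rewrite -Dj addnCA -mulSn -subSn // subn1 /=.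
by rewrite addnC mulnC modnMDl.
Qed.

(** The family number [sty] (1 to 8), the exponents [k] and [l] of the orders of
    the two generators, and the remaining parameter [sw], which is named [r],
    [rho], [j] or [t] according to the family. *)
Record hermite_shape := Shape { sty : nat; sk : nat; sl : nat; sw : nat }.

Definition shape_ok (p a b : nat) (D : hermite_shape) : Prop :=
  let: Shape q k l w := D in
  match q with
  | 1 => k <= minn a b /\ w < p ^ k
  | 2 => 1 <= k <= minn a b /\ w < p ^ (k - 1)
  | 3 => a < k <= b /\ w < p ^ a
  | 4 => b < k <= a /\ w < p ^ b
  | 5 => [/\ 1 <= l, l <= k, k <= minn a b & w < p ^ (k - l)]
  | 6 => [/\ 1 <= l, l < k, k <= minn a b & w < p ^ (k - l - 1)]
  | 7 => [/\ 1 <= l, l <= a, a < k <= b & w < p ^ (a - l)]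
  | 8 => [/\ 1 <= l, l <= b, b < k <= a & w < p ^ (b - l)]
  | _ => False
  end.

Definition genA1 (p a : nat) (D : hermite_shape) : nat :=
  let: Shape q k l w := D in
  match q with
  | 1 | 5 => w * p ^ (a - k)
  | 3 | 7 => w
  | _ => p ^ (a - k)
  end.

Definition genB1 (p b : nat) (D : hermite_shape) : nat :=
  let: Shape q k l w := D in
  match q with
  | 2 | 6 => w * p ^ (b - k + 1)
  | 4 | 8 => w
  | _ => p ^ (b - k)
  end.

Definition genA2 (p a : nat) (D : hermite_shape) : nat :=
  let: Shape q k l w := D in
  match q with 5 | 7 => p ^ (a - l) | _ => 0 end.

Definition genB2 (p b : nat) (D : hermite_shape) : nat :=
  let: Shape q k l w := D in
  match q with 6 | 8 => p ^ (b - l) | _ => 0 end.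

Definition lattice_basis (M N u1 v1 u2 v2 : nat) (L : nat -> nat -> Prop) :=
  [/\ L u1 v1, L u2 v2
    & forall u v, L u v -> exists i j,
        u = i * u1 + j * u2 %[mod M] /\ v = i * v1 + j * v2 %[mod N]].

(** [d] and [c] below are the exponents of the projections of [L] to the second
    and to the first coordinate, [e] and [f] those of its intersections with the
    axes.  The larger of [c] and [d] becomes [k]: since [L] projects into the
    multiples of [p ^ (a - c)] and of [p ^ (b - d)], the free coordinate of the
    generator of order [p ^ k] has the divisibility required by its family.
    The strict inequality [d < c] accounts for the extra factor [p] in families
    2 and 6. *)
Lemma lattice_classification p a b L : prime p ->
    lattice (p ^ a) (p ^ b) L ->
  exists2 D, shape_ok p a b D &
    lattice_basis (p ^ a) (p ^ b)
      (genA1 p a D) (genB1 p b D) (genA2 p a D) (genB2 p b D) L.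
Proof.
move=> p_pr LL; have LL' := lattice_swap LL.
have L00 := lattice0 LL.
have p1 := prime_gt1 p_pr; have p0 := prime_gt0 p_pr.
have [d [e [w [le_d le_e lt_w Lw [Le imP spanP]]]]] := hermite_form p_pr LL.
have [c [f [z [le_c le_f lt_z Lz [Lf imP' spanP']]]]] := hermite_form p_pr LL'.
have le_ec : e <= c.
  have := imP' _ _ Le; rewrite dvdn_Pexp2l //; lia.
have le_fd : f <= d.
  have := imP _ _ Lf; rewrite dvdn_Pexp2l //; lia.
have basis1 : lattice_basis (p ^ a) (p ^ b) w (p ^ (b - d)) (p ^ (a - e)) 0 L.
  split=> // u v /spanP[i [j [Du ->]]]; exists i, j; split=> //.
  by rewrite muln0 addn0.
have basis2 : lattice_basis (p ^ a) (p ^ b) (p ^ (a - c)) z 0 (p ^ (b - f)) L.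
  split=> // u v /spanP'[i [j [Dv ->]]]; exists i, j; split=> //.
  by rewrite muln0 addn0.
have basis1_0 : e = 0 -> lattice_basis (p ^ a) (p ^ b) w (p ^ (b - d)) 0 0 L.
  move=> e0; case: basis1 => H1 H2 H; split=> // u v /H[i [j [Du Dv]]].
  exists i, j; split=> //; rewrite Du e0 subn0 muln0 addn0 addnC.
  by rewrite modnMDl.
have basis2_0 : f = 0 -> lattice_basis (p ^ a) (p ^ b) (p ^ (a - c)) z 0 0 L.
  move=> e0; case: basis2 => H1 H2 H; split=> // u v /H[i [j [Du Dv]]].
  exists i, j; split=> //; rewrite Dv e0 subn0 muln0 addn0 addnC.
  by rewrite modnMDl.
have [le_cd|lt_dc] := leqP c d.
- have [le_da|lt_ad] := leqP d a.
    have /dvdnP[r Dr] : p ^ (a - d) %| w.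
      apply: dvdn_trans (imP' _ _ Lw); rewrite dvdn_Pexp2l //; lia.
    have lt_r : r < p ^ (d - e).
      rewrite -(ltn_pmul2r (m := p ^ (a - d))) ?expn_gt0 ?p0 // -Dr -expnD.
      by have -> : d - e + (a - d) = a - e by lia.
    have [e0|e0] := posnP e.
      exists (Shape 1 d 0 r); last by rewrite /= -Dr; apply: basis1_0.
      by split; [lia | rewrite e0 subn0 in lt_r].
    exists (Shape 5 d e r); last by rewrite /= -Dr.
    by split=> //; lia.
  have [e0|e0] := posnP e.
    exists (Shape 3 d 0 w); last by apply: basis1_0.
    by split; [lia | rewrite e0 subn0 in lt_w].
  by exists (Shape 7 d e w) => //; split=> //; lia.
have [le_cb|lt_bc] := leqP c b.
  have /dvdnP[r Dr] : p ^ (b - c + 1) %| z.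
    apply: dvdn_trans (imP _ _ Lz); rewrite dvdn_Pexp2l //; lia.
  have lt_r : r < p ^ (c - f - 1).
    rewrite -(ltn_pmul2r (m := p ^ (b - c + 1))) ?expn_gt0 ?p0 // -Dr -expnD.
    by have -> : c - f - 1 + (b - c + 1) = b - f by lia.
  have [f0|f0] := posnP f.
    exists (Shape 2 c 0 r); last by rewrite /= -Dr; apply: basis2_0.
    by split; [lia | rewrite f0 subn0 in lt_r].
  exists (Shape 6 c f r); last by rewrite /= -Dr.
  by split=> //; lia.
have [f0|f0] := posnP f.
  exists (Shape 4 c 0 z); last by apply: basis2_0.
  by split; [lia | rewrite f0 subn0 in lt_z].
by exists (Shape 8 c f z) => //; split=> //; lia.
Qed.

(** A trivial lattice does not contain the diagonal involution; in the other
    excluded cases a multiple of one of the generators is an involution on one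
    of the axes.  The two axes play the same role, the diagonal involution exchanging
    [(2 ^ (a - 1), 0)] and [(0, 2 ^ (b - 1))]. *)
Lemma lattice_single_involution a b L D :
    lattice (2 ^ a) (2 ^ b) L -> 0 < a -> 0 < b ->
    shape_ok 2 a b D ->
    lattice_basis (2 ^ a) (2 ^ b)
      (genA1 2 a D) (genB1 2 b D) (genA2 2 a D) (genB2 2 b D) L ->
    L (2 ^ (a - 1)) (2 ^ (b - 1)) -> ~ L (2 ^ (a - 1)) 0 ->
  [/\ sty D = 1, 0 < sk D & odd (sw D)].
Proof.
move=> LL a0 b0 okD [L1 L2 spanD] Ldiag nLa.
have [_ _ LM LN] := LL.
have nLb : ~ L 0 (2 ^ (b - 1)).
  move=> Lb; apply: nLa; apply: (lattice_modr (v := 2 ^ b) LL).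
    by rewrite modnn mod0n.
  have [La _ _ _] := LL; have := La _ _ _ _ Ldiag Lb.
  by rewrite addn0 addnn -mul2n -expnS; have -> : (b - 1).+1 = b by lia.
have mulL e u v : L u v -> L (2 ^ e * u) (2 ^ e * v) by apply: latticeM LL.
have mod0 c e f : f <= e -> 2 ^ e * c = 0 %[mod 2 ^ f].
  by move=> le_fe; apply/eqP; rewrite mod0n; apply/dvdn_mulr/dvdn_exp2l.
case: D okD L1 L2 spanD => -[|[|[|[|[|[|[|[|[|q]]]]]]]]] k l w //=.
- move=> [le_k lt_w] L1 _ spanD.
  have k0 : 0 < k.
    rewrite lt0n; apply/eqP => k0; subst k; rewrite expn0 in lt_w.
    have w0 : w = 0 by lia.
    have [i [j []]] := spanD _ _ Ldiag; rewrite w0 mul0n !muln0 mod0n.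
    move=> /eqP; rewrite -/(_ %| _) dvdn_Pexp2l //; lia.
  split=> //; apply/negP => /negP w_even.
  have := mulL (k - 1) _ _ L1.
  rewrite mulnCA -!expnD.
  have -> : k - 1 + (a - k) = a - 1 by lia.
  have -> : k - 1 + (b - k) = b - 1 by lia.
  move=> Lw; apply: nLb; apply: (lattice_modl LL) Lw.
  rewrite -(odd_double_half w) (negbTE w_even) add0n -muln2 -mulnA -expnS.
  have -> : (a - 1).+1 = a by lia.
  by rewrite modnMl mod0n.
- move=> [le_k _] /(mulL (k - 1)); rewrite mulnCA -!expnD => Lw _ _.
  case: nLa; move: Lw; have -> : k - 1 + (a - k) = a - 1 by lia.
  have -> : k - 1 + (b - k + 1) = b by lia.
  by apply: (lattice_modr LL); rewrite modnMl mod0n.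
- move=> [le_k _] /(mulL (k - 1)); rewrite -!expnD => Lw _ _.
  case: nLb; move: Lw; have -> : k - 1 + (b - k) = b - 1 by lia.
  by apply: (lattice_modl LL); apply: mod0; lia.
- move=> [le_k _] /(mulL (k - 1)); rewrite -!expnD => Lw _ _.
  case: nLa; move: Lw; have -> : k - 1 + (a - k) = a - 1 by lia.
  by apply: (lattice_modr LL); apply: mod0; lia.
- move=> [l0 le_l le_k _] _ /(mulL (l - 1)); rewrite -!expnD muln0 => Lw _.
  by case: nLa; move: Lw; have -> : l - 1 + (a - l) = a - 1 by lia.
- move=> [l0 le_l le_k _] _ /(mulL (l - 1)); rewrite -!expnD muln0 => Lw _.
  by case: nLb; move: Lw; have -> : l - 1 + (b - l) = b - 1 by lia.
- move=> [l0 le_l le_k _] _ /(mulL (l - 1)); rewrite -!expnD muln0 => Lw _.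
  by case: nLa; move: Lw; have -> : l - 1 + (a - l) = a - 1 by lia.
- move=> [l0 le_l le_k _] _ /(mulL (l - 1)); rewrite -!expnD muln0 => Lw _.
  by case: nLb; move: Lw; have -> : l - 1 + (b - l) = b - 1 by lia.
Qed.

Lemma odd_two_range k w : 0 < k -> odd w -> w < 2 ^ k -> two_range k w.
Proof.
move=> k0 w_odd lt_w; apply/andP; split; first by case: w w_odd lt_w => //; lia.
by apply/mapP => -[q _ Dw]; rewrite Dw oddM andbF in w_odd.
Qed.

(** * Direct products of parts of coprime exponents *)

Local Open Scope ring_scope.

Lemma subgroupX (T : unitRingType) (H : set T) g k :
  is_subgroup H -> H g -> H (g ^+ k).
Proof.
case=> _ H1 HM _ Hg; elim: k => [|k IHk]; first by rewrite expr0.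
by rewrite exprS; apply: HM.
Qed.

Lemma subgroup_prod (T : unitRingType) (H : set T) (s : nat) (f : 'I_s -> T) :
  is_subgroup H -> (forall i, H (f i)) -> H (\prod_(i < s) f i).
Proof. by case=> _ H1 HM _ Hf; elim/big_ind: _ => // g h; apply: HM. Qed.

Lemma sub_subgroup_gen (T : unitRingType) (S : set T) : S `<=` subgroup_gen S.
Proof. by move=> g Sg H _; apply. Qed.

Lemma subgroup_genP (T : unitRingType) (G S : set T) :
    is_subgroup G -> S `<=` G ->
    (forall H, is_subgroup H -> S `<=` H -> G `<=` H) ->
  G = subgroup_gen S.
Proof.
move=> sgG SG minG; apply/seteqP; split=> [g Gg H sgH SH|g]; last exact.
exact: minG Gg.
Qed.

Lemma subgroup_gen_set1 (T : unitRingType) (g : T) :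
  subgroup_gen [set g] = subgroup_gen [set g; 1].
Proof.
apply/seteqP; split=> h gen_h H sgH; first by move=> SH; apply: gen_h => // _ ->; apply: SH; left.
by move=> SH; apply: gen_h => // _ [->|->]; [apply: SH|case: sgH].
Qed.

Definition torsion (T : unitRingType) (q : nat) : set T := [set g | g ^+ q = 1].
Arguments torsion : clear implicits.

Lemma subgroup_torsion (T : unitRingType) (G : set T) q : is_subgroup G ->
  (forall g h, G g -> G h -> g * h = h * g) -> is_subgroup (G `&` torsion T q).
Proof.
case=> GU G1 GM GV Gcomm; split.
- by move=> g [/GU].
- by split=> //; apply: expr1n.
- move=> g h [Gg tg] [Gh th]; split; first exact: GM.
  by rewrite /torsion /= exprMn_comm ?tg ?th ?mulr1 //; apply: Gcomm.
- by move=> g [Gg tg]; split; [apply: GV|rewrite /torsion /= exprVn tg invr1].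
Qed.

Definition pairwise_coprime (s : nat) (q : 'I_s -> nat) : Prop :=
  forall i j, i != j -> coprime (q i) (q j).

Lemma crt_idempotents (s : nat) (q : 'I_s -> nat) : pairwise_coprime q ->
    (forall i, 0 < q i)%N ->
  exists e : 'I_s -> nat,
    [/\ forall i, e i = 1 %[mod q i], forall i j, i != j -> q j %| e i
      & \sum_(i < s) e i = 1 %[mod \prod_(i < s) q i]]%N.
Proof.
move=> co_q q0.
have [e He] : exists e : 'I_s -> nat, forall i,
    ((e i = 1 %[mod q i]) /\ forall j, i != j -> q j %| e i)%N.
  suff /choice[e He] : forall i, exists x : nat,
      ((x = 1 %[mod q i]) /\ forall j, i != j -> q j %| x)%N by exists e.
  move=> i; have co_i : coprime (q i) (\prod_(j < s | j != i) q j)%N.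
    apply: (@unstable.coprime_prodr _ [::] _ q i); apply/allP => x /mapP[j].
    by rewrite mem_filter => /andP[ne_ji _] ->; apply: co_q; rewrite eq_sym.
  exists (chinese (q i) (\prod_(j < s | j != i) q j)%N 1 0); split.
    exact: chinese_modl.
  move=> j ne_ij; apply: (@dvdn_trans (\prod_(j < s | j != i) q j)%N).
    by rewrite (bigD1 j) 1?eq_sym //= dvdn_mulr.
  by apply/eqP; rewrite chinese_modr // mod0n.
exists e; split=> [i|i j|]; [exact: (He i).1|exact: (He i).2|].
have sumE j : (\sum_(i < s) e i = 1 %[mod q j])%N.
  rewrite (bigD1 j) //= -modnDmr.
  rewrite (_ : (\sum_(i < s | i != j) e i) %% q j = 0)%N ?addn0 ?(He j).1 //.
  by apply/eqP; apply: dvdn_sum => i ne_ij; apply: (He i).2.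
have Q0 : (0 < \prod_(i < s) q i)%N by apply: prodn_gt0.
(* The product of the moduli is added to allow the subtraction of [1]. *)
have le1 : (1 <= \sum_(i < s) e i + \prod_(i < s) q i)%N by rewrite addnC ltn_addr.
apply/eqP; rewrite -[X in X == _]modnDr eqn_mod_dvd //.
apply/unstable.Gauss_dvd_prod => [|j _ _].
  rewrite filter_predT pairwise_map.
  have : uniq (index_enum 'I_s) by apply: index_enum_uniq.
  by rewrite uniq_pairwise; apply: sub_pairwise => i j; apply: co_q.
rewrite -eqn_mod_dvd // (bigD1 j (F := q)) //= mulnC addnC modnMDl.
by apply/eqP.
Qed.

Lemma prodrX_comm (T : unitRingType) (s : nat) (f : 'I_s -> T) k :
    (forall i j, f i * f j = f j * f i) ->
  (\prod_(i < s) f i) ^+ k = \prod_(i < s) f i ^+ k.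
Proof.
move=> fC; suff [] : (\prod_(i < s) f i) ^+ k = \prod_(i < s) f i ^+ k /\
    forall j, GRing.comm (f j) (\prod_(i < s) f i) by [].
elim: (index_enum _) => [|i r [IHr IHc]].
  by rewrite !big_nil expr1n; split=> // j; apply: commr1.
rewrite !big_cons exprMn_comm ?IHr //; split=> // j.
by apply: commrM => //; apply: fC.
Qed.

(** This recovers a factor from the product, hence both the uniqueness of the
    factorization and the fact that a subgroup containing the product contains
    each factor. *)
Lemma prod_component (T : unitRingType) (s : nat) (q e : 'I_s -> nat)
    (f : 'I_s -> T) i :
    (forall i, e i = 1 %[mod q i])%N -> (forall i j, i != j -> q j %| e i)%N ->
    (forall i j, f i * f j = f j * f i) -> (forall i, f i ^+ q i = 1) ->
  (\prod_(i < s) f i) ^+ e i = f i.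
Proof.
move=> e1 e0 fC fq; rewrite prodrX_comm // (big_only1 i) // => [|j ne_ji _].
  by rewrite -(expr_mod _ (fq i)) e1 expr_mod // expr1.
have /dvdnP[c ->] : (q j %| e i)%N by apply: e0; rewrite eq_sym.
by rewrite mulnC exprM fq expr1n.
Qed.

(** [g] is the product of its powers [g ^+ e i], because the [e i] add up to [1]
    modulo the product of the [q i], which kills [G]. *)
Lemma torsion_dprod (T : unitRingType) (s : nat) (q : 'I_s -> nat) (G : set T) :
    is_subgroup G -> (forall g h, G g -> G h -> g * h = h * g) ->
    pairwise_coprime q -> (forall i, 0 < q i)%N ->
    (forall g, G g -> g ^+ (\prod_(i < s) q i)%N = 1) ->
  internal_dprod (fun i => G `&` torsion T (q i)) G.
Proof.
move=> sgG GC co_q q0 expG; have [e [e1 e0 eS]] := crt_idempotents co_q q0.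
split.
- by move=> i; apply: subgroup_torsion.
- by move=> i j _ g h [Gg _] [Gh _]; apply: GC.
- apply/seteqP; split=> [g Gg|_ [a Ha <-]]; last first.
    by apply: subgroup_prod => // i; case: (Ha i).
  exists (fun i => g ^+ e i).
    move=> i /=; split; first exact: subgroupX.
    rewrite /torsion /= -exprM -(expr_mod _ (expG _ Gg)).
    suff /eqP-> : (\prod_(i < s) q i %| e i * q i)%N by rewrite expr0.
    rewrite (bigD1 i) //= [X in (_ %| X)%N]mulnC dvdn_pmul2l //.
    apply/unstable.Gauss_dvd_prod => [|j _ ne_ji]; last by apply: e0; rewrite eq_sym.
    rewrite pairwise_map; have : uniq [seq i0 <- index_enum 'I_s | i0 != i].
      by rewrite filter_uniq ?index_enum_uniq.
    by rewrite uniq_pairwise; apply: sub_pairwise => ? ?; apply: co_q.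
  by rewrite -expr_sum -(expr_mod _ (expG _ Gg)) eS expr_mod ?expG.
- move=> a b Ha Hb eq_ab i.
  have comp f : (forall i, (G `&` torsion T (q i)) (f i)) ->
      (\prod_(i < s) f i) ^+ e i = f i.
    move=> Hf; apply: (prod_component i e1 e0) => [j k|j]; last by case: (Hf j).
    by apply: GC; [case: (Hf j)|case: (Hf k)].
  by rewrite -(comp a) // -(comp b) // eq_ab.
Qed.

Lemma dprod_factor_sub (T : unitRingType) (s : nat) (A : 'I_s -> set T) G i :
  internal_dprod A G -> A i `<=` G.
Proof.
move=> [sgA _ -> _] g Ag; exists (fun j => if j == i then g else 1).
  by move=> j /=; case: eqP => [->|_] //; case: (sgA j).
by rewrite (big_only1 i) ?eqxx // => j /negbTE->.
Qed.

(** An element of [G] in [B i] has two factorizations along [B]: the one given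
    by [A], and the one with a single nontrivial factor. *)
Lemma dprod_factor_unique (T : unitRingType) (s : nat) (A B : 'I_s -> set T) G H :
    internal_dprod B H -> internal_dprod A G -> (forall i, A i `<=` B i) ->
  A = (fun i => G `&` B i).
Proof.
move=> dpB dpA AB; apply/funext => i; apply/seteqP; split=> [g Ag|g [Gg Bg]].
  by split; [apply: dprod_factor_sub dpA _ Ag|apply: AB].
case: (dpA) Gg => sgA _ -> _ [a Aa Dg]; case: dpB => sgB _ _ injB.
pose b j := if j == i then g else 1.
suff -> : g = a i by [].
have -> : a i = b i.
  apply: (injB a b) => [j|j|]; first by apply: AB; apply: Aa.
    by rewrite /b; case: eqP => [->|_] //; case: (sgB j).
  by rewrite Dg (big_only1 i) /b ?eqxx // => j /negbTE->.
by rewrite /b eqxx.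
Qed.

Lemma dprod_generators (T : unitRingType) (s : nat) (q : 'I_s -> nat)
    (A : 'I_s -> set T) (G : set T) (g h : 'I_s -> T) :
    is_subgroup G -> (forall g h, G g -> G h -> g * h = h * g) ->
    pairwise_coprime q -> (forall i, 0 < q i)%N ->
    internal_dprod A G -> (forall i, A i `<=` torsion T (q i)) ->
    (forall i, A i = subgroup_gen [set g i; h i]) ->
  G = subgroup_gen [set \prod_(i < s) g i; \prod_(i < s) h i].
Proof.
move=> sgG GC co_q q0 dpA Aq genA.
have [e [e1 e0 _]] := crt_idempotents co_q q0.
have Ag i : A i (g i) by rewrite genA; apply: sub_subgroup_gen; left.
have Ah i : A i (h i) by rewrite genA; apply: sub_subgroup_gen; right.
have AG i : A i `<=` G by apply: dprod_factor_sub dpA.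
apply: subgroup_genP => //.
  by move=> _ [->|->]; apply: subgroup_prod => // i; apply: AG.
move=> H sgH genH; have AH i : A i `<=` H.
  have comp f : (forall i, A i (f i)) -> H (\prod_(i < s) f i) -> H (f i).
    move=> Af Hf; rewrite -(prod_component i e1 e0 (f := f)).
    - exact: subgroupX.
    - by move=> j k; apply: GC; apply: (AG _ _ (Af _)).
    - by move=> j; apply: Aq.
  rewrite genA => x; apply=> // _ [->|->]; apply: comp => //; apply: genH.
    by left.
  by right.
have [_ _ -> _] := dpA => _ [a Aa <-].
by apply: subgroup_prod => // i; apply: (AH i); apply: Aa.
Qed.

(** * Primitive roots and rotations *)

Definition powers (U : unitRingType) (x : U) : set U := range (fun i => x ^+ i).

Lemma powers_comm (U : unitRingType) (x g h : U) :
  powers x g -> powers x h -> g * h = h * g.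
Proof. by move=> [i _ <-] [j _ <-]; rewrite -!exprD addnC. Qed.

Lemma prim_root_unit (U : unitRingType) n (x : U) :
  n.-primitive_root x -> x \is a GRing.unit.
Proof.
move=> x_prim; rewrite -(unitrX_pos _ (prim_order_gt0 x_prim)).
by rewrite (prim_expr_order x_prim) unitr1.
Qed.

Lemma subgroup_powers (U : unitRingType) n (x : U) :
  n.-primitive_root x -> is_subgroup (powers x).
Proof.
move=> x_prim; have xU := prim_root_unit x_prim.
have xX i : x ^+ i \is a GRing.unit by apply: unitrX.
split.
- by move=> _ [i _ <-].
- by exists 0%N; rewrite ?expr0.
- by move=> _ _ [i _ <-] [j _ <-]; exists (i + j)%N; rewrite ?exprD.
move=> _ [i _ <-]; exists ((n - 1) * i)%N => //.
apply: (mulIr (xX i)); rewrite mulVr // -exprD -[(_ + i)%N]addnC -mulSn subn1.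
by rewrite prednK ?(prim_order_gt0 x_prim) // exprM (prim_expr_order x_prim) expr1n.
Qed.

Lemma powers_gen (U : unitRingType) n (x : U) :
  n.-primitive_root x -> powers x = subgroup_gen [set x].
Proof.
move=> x_prim; apply: subgroup_genP; first exact: subgroup_powers x_prim.
  by move=> _ ->; exists 1%N; rewrite ?expr1.
by move=> H sgH xH _ [i _ <-]; apply: subgroupX => //; apply: xH.
Qed.

Lemma powers_torsion (U : unitRingType) n d (x : U) :
    n.-primitive_root x -> (d %| n)%N ->
  powers (x ^+ (n %/ d)) = powers x `&` torsion U d.
Proof.
move=> x_prim /dvdnP[c Dn]; have n0 := prim_order_gt0 x_prim.
have [c0 d0] : (0 < c /\ 0 < d)%N by apply/andP; rewrite -muln_gt0 -Dn.
rewrite {1}Dn mulnK //.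
apply/seteqP; split=> [_ [i _ <-]|_ [[i _ <-]]].
  split; first by exists (c * i)%N; rewrite ?exprM.
  by rewrite /torsion /= exprAC -(exprM x c d) -Dn (prim_expr_order x_prim) expr1n.
rewrite /torsion /= -exprM => /eqP; rewrite -(prim_order_dvd x_prim) Dn.
rewrite dvdn_pmul2r // => /dvdnP[j ->].
by exists j => //; rewrite mulnC exprM.
Qed.

Lemma prim_root_same_powers (U : unitRingType) n (x y : U) :
  (0 < n)%N -> n.-primitive_root x -> powers x = powers y -> n.-primitive_root y.
Proof.
move=> n0 x_prim exy.
have [i _ Dy] : powers x y by rewrite exy; exists 1%N; rewrite ?expr1.
have [j _ Dx] : powers y x by rewrite -exy; exists 1%N; rewrite ?expr1.
have yn : y ^+ n = 1 by rewrite -Dy exprAC (prim_expr_order x_prim) expr1n.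
have [m y_prim dvd_mn] := prim_order_exists n0 yn.
suff -> : n = m by [].
apply/eqP; rewrite eqn_dvd dvd_mn andbT (prim_order_dvd x_prim) -Dx exprAC.
by rewrite (prim_expr_order y_prim) expr1n.
Qed.

Lemma pair_expr (U V : unitRingType) (x : U) (y : V) k :
  ((x, y) : (U * V)%type) ^+ k = (x ^+ k, y ^+ k).
Proof. by elim: k => // k IHk; rewrite !exprS IHk. Qed.

Lemma subgroup_setX (U V : unitRingType) (A : set U) (B : set V) :
  is_subgroup A -> is_subgroup B -> @is_subgroup (U * V)%type (A `*` B).
Proof.
move=> [AU A1 AM AV] [BU B1 BM BV].
have ABU (g : (U * V)%type) : (A `*` B) g -> g \is a GRing.unit.
  case: g => [g h] [Ag Bh]; apply/unitrP; exists (g^-1, h^-1).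
  by split; congr pair; rewrite ?mulVr ?mulrV ?AU ?BU.
split=> //.
- by move=> [g h] [g' h'] [Ag Bh] [Ag' Bh']; split; [apply: AM|apply: BM].
- move=> [g h] ABgh; have [Ag Bh] := ABgh.
  have -> : (g, h)^-1 = (g^-1, h^-1) :> (U * V)%type.
    apply: (mulrI (ABU _ ABgh)); rewrite mulrV ?ABU //.
    by congr pair; rewrite mulrV ?AU ?BU.
  by split; [apply: AV|apply: BV].
Qed.

Lemma rotmxD (R : realType) (s t : R) : rotmx (s + t) = rotmx s * rotmx t.
Proof.
apply/matrixP => i j; rewrite !mxE !big_ord_recl big_ord0 addr0 !mxE /=.
rewrite cosD sinD; case: ifP => _; case: ifP => _; ring.
Qed.

Lemma rotmx0 (R : realType) : rotmx (0 : R) = 1.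
Proof.
apply/matrixP => i j; rewrite !mxE cos0 sin0 oppr0.
by case: i j => [[|[|//]] ?] [[|[|//]] ?].
Qed.

Lemma rotmxX (R : realType) (t : R) k : rotmx t ^+ k = rotmx (t * k%:R).
Proof.
elim: k => [|k IHk]; first by rewrite mulr0 rotmx0.
by rewrite exprS IHk -rotmxD -natr1 mulrDr mulr1 addrC.
Qed.

Definition rotgen (R : realType) (N : nat) : 'M[R]_2 := rotmx (2 * pi / N%:R).
Arguments rotgen : clear implicits.

Lemma rotmx_pi (R : realType) : rotmx (pi : R) = -1.
Proof.
apply/matrixP => i j; rewrite !mxE cospi sinpi oppr0.
by case: i j => [[|[|//]] ?] [[|[|//]] ?]; rewrite /= ?oppr0.
Qed.

Lemma rotgen_order (R : realType) N : (0 < N)%N -> rotgen R N ^+ N = 1.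
Proof.
move=> N0; rewrite rotmxX divfK ?pnatr_eq0 -?lt0n //.
by rewrite mulr_natl mulr2n rotmxD rotmx_pi mulrNN mulr1.
Qed.

(** [cos t = 1 - 2 sin^2 (t / 2)], and the sine is positive on [(0, pi)]. *)
Lemma rotmx_neq1 (R : realType) (t : R) : 0 < t < 2 * pi -> rotmx t <> 1.
Proof.
move=> /andP[t0 t2] /matrixP/(_ 0 0); rewrite !mxE /= => cos1.
have sin_gt0 : 0 < sin (t / 2) by apply: sin_gt0_pi; apply/andP; split; lra.
move: cos1; have -> : t = (t / 2) *+ 2 by rewrite -mulr_natr divfK ?pnatr_eq0.
rewrite cos_mulr2n => cos1; have := cos2Dsin2 (t / 2).
have : 0 < sin (t / 2) ^+ 2 by rewrite exprn_gt0.
lra.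
Qed.

Lemma rotgen_prim (R : realType) N : (0 < N)%N -> N.-primitive_root (rotgen R N).
Proof.
move=> N0; have [m m_prim dvd_mN] := prim_order_exists N0 (rotgen_order R N0).
have m0 := prim_order_gt0 m_prim.
have [lt_mN|le_Nm] := ltnP m N; last first.
  by have {1}<- : m = N by apply/eqP; rewrite eqn_leq le_Nm dvdn_leq.
case: (@rotmx_neq1 R (2 * pi / N%:R * m%:R)); last first.
  by rewrite -rotmxX (prim_expr_order m_prim).
have N0' : (0 : R) < N%:R by rewrite ltr0n.
have pi0 := pi_gt0 R.
rewrite mulrAC divr_gt0 ?mulr_gt0 ?ltr0n //= ltr_pdivrMr //.
by rewrite ltr_pM2l ?ltr_nat // mulr_gt0.
Qed.

Lemma rotgrpE (R : realType) N : (0 < N)%N -> rotgrp R N = powers (rotgen R N).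
Proof.
move=> N0; have rotE r : rotmx (2 * pi * r%:R / N%:R) = rotgen R N ^+ r.
  by rewrite rotmxX mulrAC.
apply/seteqP; split=> [_ [r _ <-]|_ [i _ <-]]; first by exists r; rewrite ?rotE.
exists (i %% N)%N; first by rewrite /= ltn_mod.
by rewrite rotE expr_mod // rotgen_order.
Qed.

Lemma rotgen_dvd (R : realType) c d : (0 < c)%N -> rotgen R d = rotgen R (c * d) ^+ c.
Proof.
move=> c0; have c0' : c%:R != 0 :> R by rewrite pnatr_eq0 -lt0n.
by rewrite rotmxX natrM invfM [c%:R^-1 * _]mulrC mulrA mulfVK.
Qed.

(** * From shapes to block parameters *)

Local Open Scope nat_scope.

(** [sg] lists the indices by increasing type, so that block [q] is made of the
    positions holding the indices of type [q]; its bounds count the indices of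
    smaller type. *)
Lemma sorting_permutation (s : nat) (ty : 'I_s -> nat) :
    (forall i, 1 <= ty i <= 8) ->
  exists sg : {perm 'I_s}, forall P : params s,
    [:: p_nu P; p_chi P; p_tau P; p_psi P; p_sigma P; p_theta P; p_phi P; p_xi P]
      = [seq count (pred1 q) [seq ty i | i <- enum 'I_s] | q <- iota 1 8] ->
    bound_N P 8 = s /\
    forall q (i : 'I_s), q <= 8 -> (bound_N P q <= i) = (q < ty (sg i)).
Proof.
move=> ty18; pose r := relpre ty leq.
have r_tot : total r by move=> i j; apply: leq_total.
have /tuple_permP[sg Dsort] : perm_eq (sort r (enum 'I_s)) (ord_tuple s).
  by rewrite val_ord_tuple perm_sort.
exists sg => P DP.
pose w := [seq ty (sg i) | i <- enum 'I_s].
have Dw : w = [seq ty i | i <- sort r (enum 'I_s)].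
  by rewrite Dsort -map_comp; apply: eq_map => i /=; rewrite tnth_ord_tuple.
have w_perm : perm_eq w [seq ty i | i <- enum 'I_s].
  by rewrite Dw perm_map // perm_sort.
have w_sorted : sorted <=%O w by rewrite Dw sorted_map sort_sorted.
have size_w : size w = s by rewrite size_map size_enum_ord.
have nth_w (i : 'I_s) : nth 0 w i = ty (sg i).
  by rewrite (nth_map i) ?size_enum_ord // nth_ord_enum.
have boundE q : q <= 8 -> bound_N P q = count (leq^~ q) w.
  rewrite /bound_N DP (seq.permP w_perm); elim: q => [|q IHq] lt_q8.
    rewrite take0 count_map (eq_count (a2 := pred0)) ?count_pred0 // => i /=.
    by have /andP[] := ty18 i; case: (ty i).
  rewrite (take_nth 0) ?size_map ?size_iota // sumn_rcons IHq 1?ltnW //.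
  rewrite (nth_map 0) ?size_iota // nth_iota // add1n.
  elim: [seq ty i | i <- enum 'I_s] => //= x l.
  by case: (ltngtP x q.+1) => /=; lia.
have blockE q (i : 'I_s) : q <= 8 -> (bound_N P q <= i) = (q < ty (sg i)).
  move=> le_q; rewrite boundE // -nth_w; apply/idP/idP => [le_i|].
    by apply: (nth_count_gt 0 w_sorted); rewrite le_i size_w /=.
  rewrite [q < _]ltnNge; apply: contraR; rewrite -ltnNge => lt_i.
  exact: (nth_count_le 0 w_sorted lt_i).
split=> //; rewrite boundE // -[RHS]size_w; apply/eqP; rewrite -all_count.
by apply/allP => _ /mapP[i _ ->]; case/andP: (ty18 (sg i)).
Qed.

(** Every index is put in a block, the trivial parts being the members of the
    first block with [k = 0]. *)
Definition shape_params (s : nat) (p al be : 'I_s -> nat)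
    (D : 'I_s -> hermite_shape) (sg : {perm 'I_s}) : params s :=
  let size q := count (pred1 q) [seq sty (D i) | i <- enum 'I_s] in
  let w i := sw (D (sg i)) in
  Params (size 1) (size 2) (size 3) (size 4) (size 5) (size 6) (size 7) (size 8)
    (fun i => p (sg i)) (fun i => al (sg i)) (fun i => be (sg i))
    (fun i => sk (D (sg i))) (fun i => sl (D (sg i))) w w w w.

Lemma shape_params_sorted (s : nat) (p al be : 'I_s -> nat)
    (D : 'I_s -> hermite_shape) :
    (forall i, shape_ok (p i) (al i) (be i) (D i)) ->
  exists sg, let P := shape_params p al be D sg in
    [/\ bound_N P 8 = s,
        forall q (i : 'I_s), q <= 8 -> (bound_N P q <= i) = (q < sty (D (sg i)))
      & forall q i, 1 <= q <= 8 -> in_block P q i = (sty (D (sg i)) == q)].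
Proof.
move=> okD; have ty18 i : 1 <= sty (D i) <= 8.
  by have := okD i; case: (D i) => -[|[|[|[|[|[|[|[|[|q]]]]]]]]] k l w.
have [sg /(_ (shape_params p al be D sg) erefl)[B8 Bq]] := sorting_permutation ty18.
exists sg; split=> // q i /andP[q1 q8]; rewrite /in_block ltnNge !Bq //; last by lia.
by rewrite prednK // -leqNgt [RHS]eq_sym eqn_leq.
Qed.

(** Each index lies in exactly one block, so the block sums add up to a sum over
    all indices, in which the permutation can be undone. *)
Lemma shape_params_exponents (s n m : nat) (p al be : 'I_s -> nat)
    (D : 'I_s -> hermite_shape) (sg : {perm 'I_s}) :
    let P := shape_params p al be D sg in
    (forall i, shape_ok (p i) (al i) (be i) (D i)) ->
    (forall q i, 1 <= q <= 8 -> in_block P q i = (sty (D (sg i)) == q)) ->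
  [/\ expA1 n P = \sum_(i < s) genA1 (p i) (al i) (D i) * (n %/ p i ^ al i),
      expB1 m P = \sum_(i < s) genB1 (p i) (be i) (D i) * (m %/ p i ^ be i),
      expA2 n P = \sum_(i < s) genA2 (p i) (al i) (D i) * (n %/ p i ^ al i)
    & expB2 m P = \sum_(i < s) genB2 (p i) (be i) (D i) * (m %/ p i ^ be i)].
Proof.
move=> P okD blockP.
split; rewrite [RHS](reindex_inj (@perm_inj _ sg)) /=;
  rewrite /expA1 /expB1 /expA2 /expB2 /= -/P;
  rewrite ![\sum_(_ < _ | in_block _ _ _) _]big_mkcond -!big_split /=;
  apply: eq_bigr => i _;
  rewrite /= !blockP //; case: (D (sg i)) (okD (sg i));
  by move=> [|[|[|[|[|[|[|[|[|q]]]]]]]]] k l w //= _; rewrite ?addn0 ?mul0n.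
Qed.

Lemma shape_params_admissible (s : nat) (p al be : 'I_s -> nat)
    (D : 'I_s -> hermite_shape) (sg : {perm 'I_s}) i0 i1 :
    let P := shape_params p al be D sg in
    injective p ->
    (forall i, shape_ok (p i) (al i) (be i) (D i)) ->
    bound_N P 8 = s ->
    (forall q (i : 'I_s), q <= 8 -> (bound_N P q <= i) = (q < sty (D (sg i)))) ->
    (forall q i, 1 <= q <= 8 -> in_block P q i = (sty (D (sg i)) == q)) ->
    p i0 = 2 -> sty (D i0) = 1 -> 0 < sk (D i0) -> odd (sw (D i0)) ->
    4 < sty (D i1) ->
  admissible p al be P.
Proof.
move=> P p_inj okD B8 Bq blockP p2 ty0 k0 w_odd ty1.
split; first by rewrite B8.
split; first by exists sg.
split.
  exists (sg^-1 i0)%g; rewrite /= permKV; split=> //.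
  by rewrite blockP //= permKV ty0.
split.
  move=> i _ /= pi2; have -> : sg i = i0 by apply: p_inj; rewrite pi2.
  have := okD i0; case: (D i0) ty0 k0 w_odd => q k l w /= -> k0 w_odd [le_k lt_w].
  by split; [rewrite k0|apply: odd_two_range; rewrite ?p2 in lt_w *].
have block q i : 1 <= q <= 8 -> in_block P q i -> sty (D (sg i)) = q.
  by move=> q18; rewrite blockP // => /eqP.
do 8![split; first by move=> i /block => /(_ isT) Dq; have := okD (sg i);
  rewrite /=; case: (D (sg i)) Dq => q k l w /= ->].
exists (sg^-1 i1)%g; rewrite Bq // permKV ty1 B8 ltn_ord; split=> //=.
rewrite permKV; have := okD i1; case: (D i1) ty1.
by move=> [|[|[|[|[|[|[|[|[|q]]]]]]]]] k l w //= _ [? ? ? _];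
  apply/eqP; rewrite muln_eq0; lia.
Qed.

(** * Primary parts of a subgroup of a product of two cyclic groups *)

Local Open Scope ring_scope.

Definition exponents (U V : unitRingType) (x : U) (y : V) (G : set (U * V)%type)
  (u v : nat) : Prop := G (x ^+ u, y ^+ v).

Lemma exponents_lattice (U V : unitRingType) M N (x : U) (y : V)
    (G : set (U * V)%type) :
    M.-primitive_root x -> N.-primitive_root y -> is_subgroup G ->
  lattice M N (exponents x y G).
Proof.
move=> x_prim y_prim [GU G1 GM GV]; rewrite /exponents.
split.
- by move=> u v u' v' Gg Gh; rewrite !exprD; apply: GM Gg Gh.
- move=> u v u' v' Gg Ggh; have := GM _ _ (GV _ Gg) Ggh; rewrite !exprD.
  by have := mulKr (GU _ Gg) (x ^+ u', y ^+ v'); rewrite [X in _ * X = _ -> _]/GRing.mul => ->.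
- by rewrite (prim_expr_order x_prim) expr0.
- by rewrite (prim_expr_order y_prim) expr0.
Qed.

Lemma lattice_basis_gen (U V : unitRingType) M N (x : U) (y : V)
    (G : set (U * V)%type) u1 v1 u2 v2 :
    M.-primitive_root x -> N.-primitive_root y -> is_subgroup G ->
    G `<=` powers x `*` powers y ->
    lattice_basis M N u1 v1 u2 v2 (exponents x y G) ->
  G = subgroup_gen [set (x ^+ u1, y ^+ v1); (x ^+ u2, y ^+ v2)].
Proof.
move=> x_prim y_prim sgG Gxy [G1 G2 spanG]; apply: subgroup_genP => //.
  by move=> _ [->|->].
move=> H sgH SH [g h] Ggh; have [[u _ Dg] [v _ Dh]] := Gxy _ Ggh.
move: Ggh Dg Dh => /[swap] /= <- /[swap] <- /spanG[i [j [Du Dv]]].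
have -> : x ^+ u = x ^+ (i * u1 + j * u2).
  by apply/eqP; rewrite (eq_prim_root_expr x_prim); apply/eqP.
have -> : y ^+ v = y ^+ (i * v1 + j * v2).
  by apply/eqP; rewrite (eq_prim_root_expr y_prim); apply/eqP.
have -> : (x ^+ (i * u1 + j * u2), y ^+ (i * v1 + j * v2)) =
    ((x ^+ u1, y ^+ v1) : (U * V)%type) ^+ i * (x ^+ u2, y ^+ v2) ^+ j.
  by rewrite !pair_expr !exprD -!exprM ![(i * _)%N]mulnC ![(j * _)%N]mulnC.
have [_ _ HM _] := sgH.
by apply: HM; apply: subgroupX => //; apply: SH; [left|right].
Qed.

(** The factor [e] allows the same exponent to be used in both coordinates of a
    primary part, whose orders [p ^ a] and [p ^ b] differ. *)
Lemma coprime_torsion (U : unitRingType) c d e (x : U) :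
    (c * d).-primitive_root x -> coprime c e ->
  powers x `&` torsion U (d * e) = powers (x ^+ c).
Proof.
move=> x_prim co_ce; have := prim_order_gt0 x_prim.
rewrite muln_gt0 => /andP[c0 d0].
rewrite -[X in x ^+ X](mulnK c d0) (powers_torsion x_prim) ?dvdn_mull //.
apply/seteqP; split=> _ [[i _ <-]] xi1; split; try by exists i.
  move: xi1; rewrite /torsion /= -!exprM => /eqP.
  rewrite -(prim_order_dvd x_prim) mulnCA [(c * d)%N]mulnC dvdn_pmul2l //.
  rewrite Gauss_dvdl // => dvd_ci; apply/eqP.
  by rewrite -(prim_order_dvd x_prim) dvdn_pmul2r.
by rewrite /torsion /= exprM xi1 expr1n.
Qed.

Lemma prod_pair (U V : unitRingType) (s : nat) (f : 'I_s -> U) (g : 'I_s -> V) :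
  \prod_(i < s) ((f i, g i) : (U * V)%type) = (\prod_(i < s) f i, \prod_(i < s) g i).
Proof. by elim: (index_enum _) => [|i r IHr]; rewrite ?big_nil // !big_cons IHr. Qed.

Section PrimaryParts.

Variables (U V : unitRingType) (s : nat) (p al be : 'I_s -> nat) (n m : nat).
Hypotheses (p_prime : forall i, prime (p i)) (p_inj : injective p).
Hypotheses (n_fact : n = (\prod_(i < s) p i ^ al i)%N).
Hypotheses (m_fact : m = (\prod_(i < s) p i ^ be i)%N).
Variables (x : U) (y : V).
Hypotheses (x_prim : n.-primitive_root x) (y_prim : m.-primitive_root y).

Let X i := x ^+ (n %/ p i ^ al i).
Let Y i := y ^+ (m %/ p i ^ be i).
Let q i := (p i ^ (al i + be i))%N.

Definition primary_part (G : set (U * V)%type) (i : 'I_s) : set (U * V)%type :=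
  G `&` (powers (X i) `*` powers (Y i)).

Lemma p_gt0 i : (0 < p i)%N. Proof. exact: prime_gt0. Qed.

Lemma coprime_p i j : i != j -> coprime (p i) (p j).
Proof.
move=> ne_ij; rewrite prime_coprime ?dvdn_prime2 //.
by apply: contra ne_ij => /eqP/p_inj->.
Qed.

Lemma q_coprime : pairwise_coprime q.
Proof. by move=> i j /coprime_p co_ij; apply/coprimeXl/coprimeXr. Qed.

Lemma q_gt0 i : (0 < q i)%N.
Proof. by rewrite expn_gt0 p_gt0. Qed.

Lemma q_prod : (\prod_(i < s) q i = n * m)%N.
Proof.
by rewrite n_fact m_fact -big_split; apply: eq_bigr => i _; rewrite /q expnD.
Qed.

Lemma cofactor_coprime (ga : 'I_s -> nat) N i (e : nat) :
    N = (\prod_(i < s) p i ^ ga i)%N ->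
  ((p i ^ ga i %| N) && coprime (N %/ p i ^ ga i) (p i ^ e))%N.
Proof.
move=> ->; rewrite (bigD1 i) //= dvdn_mulr // mulKn ?expn_gt0 ?p_gt0 //=.
rewrite coprime_sym; apply: (big_rec (coprime (p i ^ e))) => [|j k ne_ji]; first exact: coprimen1.
rewrite coprimeMr => ->; rewrite andbT.
by apply/coprimeXl/coprimeXr/coprime_p; rewrite eq_sym.
Qed.

Lemma X_prim i : (p i ^ al i).-primitive_root (X i).
Proof. by apply: dvdn_prim_root => //; case/andP: (cofactor_coprime i 0 n_fact). Qed.

Lemma Y_prim i : (p i ^ be i).-primitive_root (Y i).
Proof. by apply: dvdn_prim_root => //; case/andP: (cofactor_coprime i 0 m_fact). Qed.

Lemma powers_pair_comm (g h : (U * V)%type) :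
  (powers x `*` powers y) g -> (powers x `*` powers y) h -> g * h = h * g.
Proof.
case: g h => [g1 g2] [h1 h2] [/= Pg1 Pg2] [/= Ph1 Ph2].
by congr pair; [apply: powers_comm Pg1 Ph1|apply: powers_comm Pg2 Ph2].
Qed.

Lemma primary_torsion i :
  powers (X i) `*` powers (Y i) =
    (powers x `*` powers y) `&` torsion (U * V)%type (q i).
Proof.
have [dvd_n co_n] := andP (cofactor_coprime i (be i) n_fact).
have [dvd_m co_m] := andP (cofactor_coprime i (al i) m_fact).
have /coprime_torsion/(_ co_n) <- :
    (n %/ p i ^ al i * p i ^ al i).-primitive_root x by rewrite divnK.
have /coprime_torsion/(_ co_m) <- :
    (m %/ p i ^ be i * p i ^ be i).-primitive_root y by rewrite divnK.
rewrite -expnD [(_ ^ be i * _)%N]mulnC -expnD -/(q i).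
apply/seteqP; split=> [[g h] [[/= ? tg] [? th]]|[g h] [[/= ? ?]]].
  by split=> //; rewrite /torsion /= pair_expr tg th.
by rewrite /torsion /= pair_expr => -[? ?].
Qed.

Variable (G : set (U * V)%type).
Hypotheses (sgG : is_subgroup G) (Gxy : G `<=` powers x `*` powers y).

Lemma subgroup_pair_comm g h : G g -> G h -> g * h = h * g.
Proof. by move=> /Gxy Gg /Gxy Gh; apply: powers_pair_comm. Qed.

Lemma primary_partE i : primary_part G i = G `&` torsion (U * V)%type (q i).
Proof.
rewrite /primary_part primary_torsion; apply/seteqP.
by split=> [g [? []]|g [Gg ?]] //; split=> //; split=> //; apply: Gxy.
Qed.

Lemma primary_dprod : internal_dprod (primary_part G) G.
Proof.
have -> : primary_part G = (fun i => G `&` torsion (U * V)%type (q i)).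
  by apply/funext => i; apply: primary_partE.
apply: torsion_dprod => //.
- exact: subgroup_pair_comm.
- exact: q_coprime.
- exact: q_gt0.
move=> g /Gxy; case: g => g h [[i _ /= <-] [j _ /= <-]].
rewrite q_prod pair_expr -!exprM ![(i * _)%N]mulnC ![(j * _)%N]mulnC.
rewrite [in X in (_, X)](mulnC n) -!mulnA !exprM.
by rewrite (prim_expr_order x_prim) (prim_expr_order y_prim) !expr1n.
Qed.

Lemma primary_generators (g h : 'I_s -> (U * V)%type) :
    (forall i, primary_part G i = subgroup_gen [set g i; h i]) ->
  G = subgroup_gen [set \prod_(i < s) g i; \prod_(i < s) h i].
Proof.
apply: (dprod_generators sgG subgroup_pair_comm q_coprime q_gt0 primary_dprod).
by move=> i; rewrite primary_partE => g' [].
Qed.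

Lemma primary_shape i : exists D,
  [/\ shape_ok (p i) (al i) (be i) D,
      lattice_basis (p i ^ al i) (p i ^ be i)
        (genA1 (p i) (al i) D) (genB1 (p i) (be i) D)
        (genA2 (p i) (al i) D) (genB2 (p i) (be i) D)
        (exponents (X i) (Y i) (primary_part G i))
    & primary_part G i = subgroup_gen
        [set (X i ^+ genA1 (p i) (al i) D, Y i ^+ genB1 (p i) (be i) D);
             (X i ^+ genA2 (p i) (al i) D, Y i ^+ genB2 (p i) (be i) D)]].
Proof.
have sgA : is_subgroup (primary_part G i) by case: primary_dprod.
have AXY : primary_part G i `<=` powers (X i) `*` powers (Y i) by move=> g [].
have LL := exponents_lattice (X_prim i) (Y_prim i) sgA.
have [D okD basisD] := lattice_classification (p_prime i) LL.
exists D; split=> //.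
exact: lattice_basis_gen (X_prim i) (Y_prim i) sgA AXY basisD.
Qed.

Lemma primary_exponents (D : 'I_s -> hermite_shape) :
    (forall i, primary_part G i = subgroup_gen
      [set (X i ^+ genA1 (p i) (al i) (D i), Y i ^+ genB1 (p i) (be i) (D i));
           (X i ^+ genA2 (p i) (al i) (D i), Y i ^+ genB2 (p i) (be i) (D i))]) ->
  let sumx f := (\sum_(i < s) f (p i) (al i) (D i) * (n %/ p i ^ al i))%N in
  let sumy f := (\sum_(i < s) f (p i) (be i) (D i) * (m %/ p i ^ be i))%N in
  G = subgroup_gen [set (x ^+ sumx genA1, y ^+ sumy genB1);
                        (x ^+ sumx genA2, y ^+ sumy genB2)].
Proof.
have prodE (W : unitRingType) (z : W) (c f : 'I_s -> nat) :
    z ^+ (\sum_(i < s) f i * c i)%N = \prod_(i < s) z ^+ c i ^+ f i.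
  by rewrite expr_sum; apply: eq_bigr => i _; rewrite mulnC exprM.
by move=> genA /=; rewrite !prodE -!prod_pair; apply: primary_generators.
Qed.

Lemma primary_cyclic : (forall i, is_cyclic (primary_part G i)) -> is_cyclic G.
Proof.
move=> /boolp.choice[f Df]; exists (\prod_(i < s) f i).
have prod1 : \prod_(i < s) (1 : (U * V)%type) = 1 by apply: big1_eq.
rewrite subgroup_gen_set1 -[X in [set _; X]]prod1.
by apply: primary_generators => i; rewrite Df subgroup_gen_set1.
Qed.

(** The element [-1] is the half-order power of the generator of the 2-primary
    part of each factor, so the hypotheses on [(-1, -1)] and [(-1, 1)] are
    about [(2 ^ (a - 1), 2 ^ (b - 1))] and [(2 ^ (a - 1), 0)] in the lattice. *)
Lemma primary_two i D :
    p i = 2%N -> (0 < al i)%N -> (0 < be i)%N ->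
    -1 != 1 :> U -> -1 != 1 :> V -> powers x (-1) -> powers y (-1) ->
    G (-1, -1) -> ~ G (-1, 1) ->
    shape_ok (p i) (al i) (be i) D ->
    lattice_basis (p i ^ al i) (p i ^ be i)
      (genA1 (p i) (al i) D) (genB1 (p i) (be i) D)
      (genA2 (p i) (al i) D) (genB2 (p i) (be i) D)
      (exponents (X i) (Y i) (primary_part G i)) ->
  [/\ sty D = 1, 0 < sk D & odd (sw D)]%N.
Proof.
move=> p2 a0 b0 NU NV xN yN GN nG okD basisD.
have halfE (W : unitRingType) (N a : nat) (z : W) :
    N.-primitive_root z -> (p i ^ a %| N)%N -> (0 < a)%N -> -1 != 1 :> W ->
    powers z (-1) ->
    powers (z ^+ (N %/ p i ^ a)) (-1) /\ z ^+ (N %/ p i ^ a) ^+ (2 ^ (a - 1)) = -1.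
  move=> z_prim dvd_a a_gt0 NW zN.
  have Da : (2 ^ a = 2 * 2 ^ (a - 1))%N by rewrite -expnS; congr (2 ^ _)%N; lia.
  have zaN : powers (z ^+ (N %/ p i ^ a)) (-1).
    rewrite (powers_torsion z_prim dvd_a); split=> //.
    by rewrite /torsion /= p2 Da exprM sqrrN !expr1n.
  split=> //; case: zaN => j _; have := dvdn_prim_root z_prim dvd_a.
  set t := z ^+ _; rewrite p2 => t_prim Dj.
  (* [-1] is [t ^+ j] with [j] an odd multiple of half the order of [t]. *)
  have /dvdnP[c Dc] : (2 ^ (a - 1) %| j)%N.
    rewrite -(dvdn_pmul2l (p := 2)) // -Da (prim_order_dvd t_prim) mulnC exprM Dj.
    by rewrite sqrrN expr1n.
  move: Dj; rewrite Dc; case: (boolP (odd c)) => [c_odd|c_even].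
    rewrite -[c]odd_double_half c_odd -mul2n mulnDl mul1n mulnAC -Da exprD.
    by rewrite [X in _ * X]exprM (prim_expr_order t_prim) expr1n mulr1.
  rewrite -[c]odd_double_half (negbTE c_even) add0n -mul2n mulnAC -Da exprM.
  by rewrite (prim_expr_order t_prim) expr1n => /esym/eqP; rewrite (negbTE NW).
have [dvd_n _] := andP (cofactor_coprime i 0 n_fact).
have [dvd_m _] := andP (cofactor_coprime i 0 m_fact).
have [XN XE] := halfE _ _ _ _ x_prim dvd_n a0 NU xN.
have [YN YE] := halfE _ _ _ _ y_prim dvd_m b0 NV yN.
have LL : lattice (p i ^ al i) (p i ^ be i)
    (exponents (X i) (Y i) (primary_part G i)).
  by apply: exponents_lattice (X_prim i) (Y_prim i) _; case: primary_dprod.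
rewrite p2 in okD basisD LL.
apply: (lattice_single_involution LL) => //; rewrite /exponents XE ?YE ?expr0.
  by split.
by case.
Qed.

End PrimaryParts.

(** * Subgroups of a product of two rotation groups *)

Lemma diag2E (R : realType) k w : diag2 R k w =
  powers ((rotgen R (2 ^ k) ^+ w, rotgen R (2 ^ k)) : ('M[R]_2 * 'M[R]_2)%type).
Proof.
have elemE i : (rotmx (2 * pi / (2 ^ k)%:R * w%:R * i%:R : R),
    rotmx (2 * pi / (2 ^ k)%:R * i%:R : R)) =
    ((rotgen R (2 ^ k) ^+ w, rotgen R (2 ^ k)) : ('M[R]_2 * 'M[R]_2)%type) ^+ i.
  by rewrite pair_expr -exprM !rotmxX natrM mulrA.
have k0 : (0 < 2 ^ k)%N by rewrite expn_gt0.
apply/seteqP; split=> [_ [i _ <-]|_ [i _ <-]]; first by exists i; rewrite ?elemE.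
exists (i %% 2 ^ k)%N; first by rewrite /= ltn_mod.
rewrite elemE expr_mod // pair_expr -exprM mulnC exprM rotgen_order //.
by rewrite expr1n.
Qed.

Lemma rotgen_half_turn (R : realType) N : (0 < N)%N -> ~~ odd N ->
  powers (rotgen R N) (-1).
Proof.
move=> N0 /even_halfK DN; have N2 : (0 < N./2)%N by lia.
exists N./2 => //; rewrite -[X in rotgen R X]DN -mul2n mulnC -rotgen_dvd //.
by rewrite /rotgen mulrAC divff ?pnatr_eq0 // mul1r rotmx_pi.
Qed.

Lemma minus1_neq1 (R : realType) : -1 != 1 :> 'M[R]_2.
Proof.
apply/eqP; rewrite -rotmx_pi; apply: rotmx_neq1.
have := pi_gt0 R; lra.
Qed.

Lemma rotgrp_power (R : realType) N d : (0 < N)%N -> (d %| N)%N ->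
  rotgrp R d = powers (rotgen R N ^+ (N %/ d)).
Proof.
move=> N0 dvd_d; have d0 := dvdn_gt0 N0 dvd_d.
rewrite rotgrpE // -[X in rotgen R X ^+ _](divnK dvd_d) -rotgen_dvd //.
by rewrite divn_gt0 // dvdn_leq.
Qed.

(** This makes an arbitrary generator of the rotation group usable in place of
    the standard one. *)
Lemma gen_rotgrp_prim (R : realType) N (x : 'M[R]_2) : (0 < N)%N ->
  rotgrp R N = subgroup_gen [set x] ->
  N.-primitive_root x /\ powers x = rotgrp R N.
Proof.
move=> N0 gen_x.
have [i _ Dx] : powers (rotgen R N) x.
  by rewrite -rotgrpE // gen_x; apply: sub_subgroup_gen.
have xN : x ^+ N = 1 by rewrite -Dx exprAC rotgen_order // expr1n.
have [d x_prim _] := prim_order_exists N0 xN.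
have Dpow : powers x = rotgrp R N by rewrite gen_x (powers_gen x_prim).
split=> //; apply: (prim_root_same_powers N0 (rotgen_prim R N0)).
by rewrite Dpow rotgrpE.
Qed.

Theorem proposition16 (R : realType) (s : nat) (p al be : 'I_s.+1 -> nat)
    (n m : nat)
    (n_gt0 : (0 < n)%N) (n_even : ~~ odd n)
    (m_gt0 : (0 < m)%N) (m_even : ~~ odd m)
    (p_prime : forall i, prime (p i)) (p_inj : injective p)
    (p_first : p ord0 = 2%N)
    (al_first : (1 <= al ord0)%N) (be_first : (1 <= be ord0)%N)
    (n_fact : n = (\prod_(i < s.+1) p i ^ al i)%N)
    (m_fact : m = (\prod_(i < s.+1) p i ^ be i)%N) :
  internal_dprod
    (fun i => rotgrp R (p i ^ al i) `*` rotgrp R (p i ^ be i))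
    (rotgrp R n `*` rotgrp R m)
  /\
  forall G : set ('M[R]_2 * 'M[R]_2)%type,
    class_E1 n m G -> two_generators G ->
    (exists A : 'I_s.+1 -> set ('M[R]_2 * 'M[R]_2)%type,
       [/\ unique (decomposition p al be G) A,
           A ord0 <> [set 1],
           is_cyclic (A ord0),
           exists kappa r : nat,
             [/\ (1 <= kappa <= minn (al ord0) (be ord0))%N,
                 two_range kappa r
               & A ord0 = diag2 R kappa r]
         & exists i, i != ord0 /\ two_generators (A i)])
    /\
    forall x y : 'M[R]_2,
      rotgrp R n = subgroup_gen [set x] -> rotgrp R m = subgroup_gen [set y] ->
      exists P : params s.+1,
        admissible p al be P /\
        G = subgroup_gen [set (x ^+ expA1 n P, y ^+ expB1 m P);
                     (x ^+ expA2 n P, y ^+ expB2 m P)].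
Proof.
have rot_n := rotgen_prim R n_gt0; have rot_m := rotgen_prim R m_gt0.
pose part := primary_part p al be n m (rotgen R n) (rotgen R m).
pose Gam := powers (rotgen R n) `*` powers (rotgen R m).
have sgGam : is_subgroup Gam.
  exact: subgroup_setX (subgroup_powers rot_n) (subgroup_powers rot_m).
have dvd_n i : (p i ^ al i %| n)%N by rewrite n_fact (bigD1 i) // dvdn_mulr.
have dvd_m i : (p i ^ be i %| m)%N by rewrite m_fact (bigD1 i) // dvdn_mulr.
have partE G i : part G i =
    G `&` (rotgrp R (p i ^ al i) `*` rotgrp R (p i ^ be i)).
  by rewrite (rotgrp_power R n_gt0) // (rotgrp_power R m_gt0).
have dpGam : internal_dprod
    (fun i => rotgrp R (p i ^ al i) `*` rotgrp R (p i ^ be i)) Gam.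
  have -> : (fun i => rotgrp R (p i ^ al i) `*` rotgrp R (p i ^ be i)) = part Gam.
    apply/funext => i; rewrite partE setIidr //.
    rewrite (rotgrp_power R n_gt0) // (rotgrp_power R m_gt0) //.
    by rewrite (primary_torsion p_prime p_inj n_fact m_fact rot_n rot_m) => g [].
  exact: (primary_dprod p_prime p_inj n_fact m_fact rot_n rot_m sgGam).
split; first by rewrite (rotgrpE R n_gt0) (rotgrpE R m_gt0).
move=> G [sgG Gnm GN nG4] [_ nGcyc].
have nGN1 : ~ G (-1, 1).
  move=> GN1; apply: nG4; have [_ G1 GM _] := sgG.
  have GNM : G (1, -1).
    have := GM _ _ GN GN1; rewrite [_ * _](_ : _ = (1, -1)) //.
    by congr pair; rewrite ?mulrNN ?mulr1.
  by move=> _ [[[->|->]|->]|->].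
have Ggam : G `<=` Gam by rewrite (rotgrpE R n_gt0) (rotgrpE R m_gt0) in Gnm.
(* The standard generators serve to describe the part at 2, arbitrary ones to
   write the generators of [G]. *)
have classify x y : n.-primitive_root x -> m.-primitive_root y ->
    powers x = rotgrp R n -> powers y = rotgrp R m ->
    exists D : 'I_s.+1 -> hermite_shape,
      [/\ forall i, shape_ok (p i) (al i) (be i) (D i),
          [/\ sty (D ord0) = 1, 0 < sk (D ord0) & odd (sw (D ord0))]%N
        & forall i, primary_part p al be n m x y G i = subgroup_gen
          [set (x ^+ (n %/ p i ^ al i) ^+ genA1 (p i) (al i) (D i),
                y ^+ (m %/ p i ^ be i) ^+ genB1 (p i) (be i) (D i));
               (x ^+ (n %/ p i ^ al i) ^+ genA2 (p i) (al i) (D i),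
                y ^+ (m %/ p i ^ be i) ^+ genB2 (p i) (be i) (D i))]].
  move=> x_prim y_prim Dx Dy.
  have Gxy : G `<=` powers x `*` powers y by rewrite Dx Dy.
  have [D HD] := boolp.choice
    (primary_shape p_prime p_inj n_fact m_fact x_prim y_prim sgG Gxy).
  exists D; split=> [i||i]; [by case: (HD i)| |by case: (HD i)].
  have [okD basisD _] := HD ord0.
  apply: (primary_two p_prime p_inj n_fact m_fact x_prim y_prim sgG Gxy
    p_first al_first be_first) => //.
  - exact: minus1_neq1.
  - exact: minus1_neq1.
  - by rewrite Dx rotgrpE //; apply: rotgen_half_turn.
  - by rewrite Dy rotgrpE //; apply: rotgen_half_turn.
split.
  have [D [okD [ty0 k0 w_odd] genA]] :=
    classify _ _ rot_n rot_m (esym (rotgrpE R n_gt0)) (esym (rotgrpE R m_gt0)).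
  have dpG : internal_dprod (part G) G.
    exact: (primary_dprod p_prime p_inj n_fact m_fact rot_n rot_m sgG Ggam).
  have part0 : part G ord0 = subgroup_gen
      [set (rotgen R (2 ^ sk (D ord0)) ^+ sw (D ord0), rotgen R (2 ^ sk (D ord0)))].
    rewrite /part genA subgroup_gen_set1.
    have le_k : (sk (D ord0) <= minn (al ord0) (be ord0))%N.
      by have := okD ord0; case: (D ord0) ty0 => q k l w /= -> [].
    have rot_part N ga : (0 < N)%N -> (p ord0 ^ ga %| N)%N ->
        (sk (D ord0) <= ga)%N ->
        rotgen R N ^+ (N %/ p ord0 ^ ga) ^+ (p ord0 ^ (ga - sk (D ord0))) =
        rotgen R (2 ^ sk (D ord0)).
      move=> N0 dvd_ga le_ga; rewrite -exprM.
      rewrite {1}p_first in dvd_ga; rewrite p_first.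
      have DN : N = (N %/ 2 ^ ga * 2 ^ (ga - sk (D ord0)) * 2 ^ sk (D ord0))%N.
        by rewrite -mulnA -expnD subnK // divnK.
      rewrite [X in rotgen R X]DN -rotgen_dvd // lt0n.
      by apply/negP => /eqP c0; move: N0; rewrite DN c0.
    have [le_ka le_kb] : (sk (D ord0) <= al ord0 /\ sk (D ord0) <= be ord0)%N.
      by apply/andP; rewrite -leq_min.
    have Rn := rot_part n (al ord0) n_gt0 (dvd_n ord0) le_ka.
    have Rm := rot_part m (be ord0) m_gt0 (dvd_m ord0) le_kb.
    move: Rn Rm; case: (D ord0) ty0 => q k l w /= -> Rn Rm /=.
    by rewrite mulnC exprM Rn Rm !expr0.
  have diag0 : part G ord0 = diag2 R (sk (D ord0)) (sw (D ord0)).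
    have k20 : (0 < 2 ^ sk (D ord0))%N by rewrite expn_gt0.
    rewrite part0 diag2E; set g := (_, _).
    have gN : g ^+ (2 ^ sk (D ord0)) = 1.
      by rewrite pair_expr exprAC rotgen_order // expr1n.
    by have [d g_prim _] := prim_order_exists k20 gN; rewrite (powers_gen g_prim).
  have cyc0 : is_cyclic (part G ord0) by eexists; exact: part0.
  exists (part G); split.
  - split.
      split=> // i; split; last by rewrite partE => g [].
      by case: dpG.
    move=> A [sgA dpA]; apply/esym.
    rewrite (dprod_factor_unique dpGam dpA (fun i => (sgA i).2)).
    by apply/funext => i; rewrite partE.
  - have : part G ord0 (-1, -1).
      rewrite partE; split=> //.
      have even0 ga : (0 < ga)%N -> rotgrp R (p ord0 ^ ga) (-1).
        move=> ga0; rewrite p_first rotgrpE ?expn_gt0 //.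
        by apply: rotgen_half_turn; rewrite ?expn_gt0 // oddX negb_or -lt0n ga0.
      by split; apply: even0.
    by move=> /[swap] -> [/eqP]; rewrite (negbTE (minus1_neq1 R)).
  - exact: cyc0.
  - exists (sk (D ord0)), (sw (D ord0)).
    have := okD ord0; case: (D ord0) ty0 k0 w_odd diag0 => q k l w /= ->.
    move=> k0 w_odd diag0 [le_k lt_w]; split=> //; first by rewrite k0.
    by apply: odd_two_range; rewrite ?p_first in lt_w *.
  - apply: boolp.contrapT => no_two; apply: nGcyc.
    apply: (primary_cyclic p_prime p_inj n_fact m_fact rot_n rot_m sgG Ggam) => i.
    have [->|i0] := eqVneq i ord0; first exact: cyc0.
    apply: boolp.contrapT => ncyc; apply: no_two; exists i; split=> //.
    by split=> //; do 2!eexists; exact: genA.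
move=> x y /(gen_rotgrp_prim n_gt0)[x_prim Dx] /(gen_rotgrp_prim m_gt0)[y_prim Dy].
have [D [okD [ty0 k0 w_odd] genA]] := classify _ _ x_prim y_prim Dx Dy.
have Gxy : G `<=` powers x `*` powers y by rewrite Dx Dy.
have [sg [B8 Bq blockP]] := shape_params_sorted okD.
have genG := primary_exponents p_prime p_inj n_fact m_fact x_prim y_prim sgG Gxy genA.
have [i1 ty1] : exists i1, (4 < sty (D i1))%N.
  apply: boolp.contrapT => no_ty; apply: nGcyc.
  apply: (primary_cyclic p_prime p_inj n_fact m_fact x_prim y_prim sgG Gxy) => i.
  rewrite genA; have : ~~ (4 < sty (D i))%N by apply/negP => ty_i; apply: no_ty; exists i.
  case: (D i) => -[|[|[|[|[|q]]]]] k l w //= _; rewrite !expr0 -subgroup_gen_set1;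
    by eexists.
exists (shape_params p al be D sg); split.
  exact: (shape_params_admissible p_inj okD B8 Bq blockP p_first ty0 k0 w_odd ty1).
by have [-> -> -> ->] := shape_params_exponents n m okD blockP.
Qed.
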